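(* Let $S$ be a $\Gamma$-semiring which has a left unity and a right unity, and let $R$ be its right operator semiring. For a fuzzy subset $\sigma$ of $S$ let $\sigma^{*'}$ be the fuzzy subset of $R$ defined by $\sigma^{*'}(\sum_i[\alpha_i,x_i])=\inf_{a\in S}\sigma(\sum_i a\alpha_i x_i)$. Then the map $\sigma\mapsto\sigma^{*'}$ is an inclusion preserving bijection from the set of all fuzzy $k$-ideals of $S$ to the set of all fuzzy $k$-ideals of $R$. Likewise, the map $\sigma\mapsto\sigma^{*'}$ is an inclusion preserving bijection from the set of all fuzzy $h$-ideals of $S$ to the set of all fuzzy $h$-ideals of $R$.
   Context: $\Gamma$-semiring: $S$ and $\Gamma$ are (nonempty) additive commutative semigroups with a map $S\times\Gamma\times S\to S$, $(a,\alpha,b)\mapsto a\alpha b$, such that $a\alpha(b+c)=a\alpha b+a\alpha c$, $(a+b)\alpha c=a\alpha c+b\alpha c$, $a(\alpha+\beta)c=a\alpha c+a\beta c$, $a\alpha(b\beta c)=(a\alpha b)\beta c$ for all $a,b,c\in S$, $\alpha,\beta\in\Gamma$. No zero elements are assumed. Right operator semiring $R$: let $G$ be the free additive commutative semigroup generated by $\Gamma\times S$ (finite nonempty formal sums). Identify $\sum_i(\alpha_i,x_i)$ with $\sum_j(\beta_j,y_j)$ iff $\sum_i a\alpha_i x_i=\sum_j a\beta_j y_j$ for all $a\in S$; this is a congruence on $G$. The class of $\sum_i(\alpha_i,x_i)$ is written $\sum_i[\alpha_i,x_i]$. $R$ is the quotient, with the induced addition and the multiplication $(\sum_i[\alpha_i,x_i])(\sum_j[\beta_j,y_j])=\sum_{i,j}[\alpha_i,x_i\beta_j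 y_j]$; it is a semiring. Unities: a right unity of $S$ is a finite sum $\sum_j[\gamma_j,f_j]\in R$ with $\sum_j a\gamma_j f_j=a$ for all $a\in S$. A left unity of $S$ is given by finitely many $e_i\in S$, $\delta_i\in\Gamma$ with $\sum_i e_i\delta_i a=a$ for all $a\in S$. A fuzzy subset of a set $X$ is a function $X\to[0,1]$; inclusion of fuzzy subsets is the pointwise order ($\sigma\le\tau$ iff $\sigma(x)\le\tau(x)$ for all $x$). Inclusion preserving means $\sigma\le\tau$ implies $\sigma^{*'}\le\tau^{*'}$. A fuzzy subset $\mu$ of $S$ is a fuzzy ideal of $S$ if $\mu(a+b)\ge\min(\mu(a),\mu(b))$, $\mu(a\alpha b)\ge\mu(a)$ and $\mu(a\alpha b)\ge\mu(b)$ for all $a,b\in S$, $\alpha\in\Gamma$. A fuzzy subset $\mu$ of $R$ is a fuzzy ideal of $R$ if $\mu(p+q)\ge\min(\mu(p),\mu(q))$, $\mu(pq)\ge\mu(p)$ and $\mu(pq)\ge\mu(q)$ for all $p,q\in R$. A fuzzy ideal $\mu$ (of $S$ or of $R$) is a fuzzy $k$-ideal if $\mu(x)\ge\min(\mu(x+y),\mu(y))$ for all $x,y$ (in $S$, respectively in $R$); it is a fuzzy $h$-ideal if for all $x,z,y_1,y_2$ (in $S$, respectively in $R$), $x+y_1+z=y_2+z$ implies $\mu(x)\ge\min(\mu(y_1),\mu(y_2))$. *)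

(* Defs.v *)
From HB Require Import structures.
From mathcomp Require Import all_boot all_order all_algebra finmap multiset.
From mathcomp Require Import generic_quotient.
From mathcomp Require Import all_classical all_reals.

Set Implicit Arguments.
Unset Strict Implicit.
Unset Printing Implicit Defensive.
Import Order.TTheory GRing.Theory Num.Theory.
Local Open Scope classical_set_scope.
Local Open Scope quotient_scope.
Local Open Scope ring_scope.

(* [addSemigroupType] is MathComp's commutative additive semigroup (no zero).
   Without a zero, only sums of nonempty sequences are meaningful: [d] is a
   junk value for [::], and every use below is at a nonempty sequence. *)
Definition nesum (V : addSemigroupType) (d : V) (s : seq V) : V :=
  if s is x :: s' then foldl +%R x s' else d.

Section NeSum.
Variable V : addSemigroupType.
Implicit Types (d x y : V) (s t : seq V).

Lemma nesum_default d d' s : s != [::] -> nesum d s = nesum d' s.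
Proof. by case: s. Qed.

Lemma nesum_cons d x s : s != [::] -> nesum d (x :: s) = x + nesum d s.
Proof.
case: s => //= y s _; elim: s x y => //= z s IHs x y.
by rewrite -Algebra.addrA; exact: IHs.
Qed.

Lemma nesum_cat d s t : s != [::] -> t != [::] ->
  nesum d (s ++ t) = nesum d s + nesum d t.
Proof.
move=> + t0; elim: s => // x s IHs _.
have [->|s0] := eqVneq s [::]; first by rewrite cat1s nesum_cons.
rewrite cat_cons !nesum_cons ?IHs ?Algebra.addrA//.
by case: (s) s0.
Qed.

Lemma perm_nesum d s t : perm_eq s t -> nesum d s = nesum d t.
Proof.
move=> st; pose P u := nesum d s = nesum d u; rewrite -/(P t).
apply: (@catCA_perm_ind _ P _ _ _ st) => //; rewrite /P => {t st P} t u v ->.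
have [->//|t0] := eqVneq t [::]; have [->//|u0] := eqVneq u [::].
have tuC : nesum d (t ++ u) = nesum d (u ++ t).
  by rewrite !nesum_cat// Algebra.addrC.
have [->|v0] := eqVneq v [::]; first by rewrite !cats0.
rewrite !catA [LHS]nesum_cat ?[RHS]nesum_cat ?tuC//.
  by case: (u) u0.
by case: (t) t0.
Qed.

Lemma nesum_mapD (I : eqType) (f g : I -> V) d (r : seq I) : r != [::] ->
  nesum d [seq f i + g i | i <- r] = nesum d (map f r) + nesum d (map g r).
Proof.
elim: r => // i r IHr _; have [->//|r0] := eqVneq r [::].
have m0 (h : I -> V) : map h r != [::] by case: (r) r0.
rewrite !map_cons !nesum_cons// IHr// !Algebra.addrA; congr (_ + _).
by rewrite -!Algebra.addrA; congr (_ + _); rewrite Algebra.addrC.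
Qed.

End NeSum.

Record gammaSemiring (S Gam : addSemigroupType) := GammaSemiring {
  gmul :> S -> Gam -> S -> S;
  gmulDr : forall a al b c, gmul a al (b + c) = gmul a al b + gmul a al c;
  gmulDl : forall a b al c, gmul (a + b) al c = gmul a al c + gmul b al c;
  gmulDm : forall a al be c, gmul a (al + be) c = gmul a al c + gmul a be c;
  gmulA : forall a al b be c, gmul a al (gmul b be c) = gmul (gmul a al b) be c;
  gamma_carrier_inhabited : inhabited S;
  gamma_index_inhabited : inhabited Gam
}.

(* The free commutative semigroup on [Gam * S]: nonempty finite multisets. *)
Section FreeSemigroup.
Variables S Gam : addSemigroupType.
Local Open Scope mset_scope.

Definition formal_sum := {m : {mset (Gam * S)%type} | m != mset0}.
HB.instance Definition _ := Choice.on formal_sum.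

Implicit Types g h : formal_sum.

Definition fterms g : seq (Gam * S) := enum_mset (val g).

Lemma fterms_neq0 g : fterms g != [::].
Proof.
by rewrite /fterms -size_eq0 size_mset_eq0; exact: (valP g).
Qed.

Lemma fadd_proof g h : val g `+` val h != mset0.
Proof.
apply: contra_neq (valP g) => /msetP gh0; apply/msetP => x.
by have := gh0 x; rewrite msetE2 mset0E => /eqP; rewrite addn_eq0 => /andP[/eqP].
Qed.

Definition fadd g h : formal_sum := Sub (val g `+` val h) (fadd_proof g h).

Lemma faddC : commutative fadd.
Proof. by move=> g h; apply: val_inj; rewrite /= msetDC. Qed.

Lemma faddA : associative fadd.
Proof. by move=> g h k; apply: val_inj; rewrite /= msetDA. Qed.

HB.instance Definition _ := Algebra.isAddSemigroup.Build formal_sum faddC faddA.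

Lemma seq_mset_neq0 (s : seq (Gam * S)) : s != [::] -> seq_mset s != mset0.
Proof.
rewrite -[seq_mset s == _]size_mset_eq0 (perm_size (perm_eq_seq_mset s)).
by rewrite size_eq0.
Qed.

Lemma ftermsD g h : perm_eq (fterms (g + h)) (fterms g ++ fterms h).
Proof.
by apply/allP => x _ /=; rewrite count_cat !count_mem_mset /= msetE2.
Qed.

End FreeSemigroup.

Section OperatorSemiring.
Variables (S Gam : addSemigroupType) (M : gammaSemiring S Gam).
Implicit Types (a b : S) (g h : formal_sum S Gam).

(* [sum_i a alpha_i x_i], for the formal sum [g = sum_i (alpha_i, x_i)] *)
Definition feval a g : S := nesum a [seq M a p.1 p.2 | p <- fterms g].

(* (sum_i (alpha_i, x_i)) (sum_j (beta_j, y_j)) =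
   sum_{i,j} (alpha_i, x_i beta_j y_j) *)
Definition fmul_mset g h : {mset (Gam * S)%type}%mset :=
  seq_mset [seq (p.1, M p.2 q.1 q.2) | p <- fterms g, q <- fterms h].

Lemma fmul_proof g h : fmul_mset g h != mset0.
Proof.
apply: seq_mset_neq0; have := fterms_neq0 g; have := fterms_neq0 h.
by case: (fterms g) => // p s; case: (fterms h).
Qed.

Definition fmul g h : formal_sum S Gam :=
  Sub (fmul_mset g h) (fmul_proof g h).

Definition oprel g h : bool := `[< forall a, feval a g = feval a h >].

Lemma oprel_refl : reflexive oprel.
Proof. by move=> g; apply/asboolP. Qed.

Lemma oprel_sym : symmetric oprel.
Proof. by move=> g h; apply/asboolP/asboolP => e a; rewrite e. Qed.

Lemma oprel_trans : transitive oprel.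
Proof.
by move=> h g k /asboolP gh /asboolP hk; apply/asboolP => a; rewrite gh hk.
Qed.

Canonical oprel_equiv := EquivRel oprel oprel_refl oprel_sym oprel_trans.

Definition opsemiring := {eq_quot oprel}.
HB.instance Definition _ := Choice.on opsemiring.
HB.instance Definition _ := EqQuotient.on opsemiring.

Implicit Types p q r : opsemiring.

(* [sum_i a alpha_i x_i], for the class [p = sum_i [alpha_i, x_i]] *)
Definition opact a p : S := feval a (repr p).
Definition opadd p q : opsemiring := \pi_opsemiring (repr p + repr q).
Definition opmul p q : opsemiring := \pi_opsemiring (fmul (repr p) (repr q)).

Lemma opact_pi a g : opact a (\pi_opsemiring g) = feval a g.
Proof.
by have /eqmodP/asboolP/(_ a) := reprK (\pi_opsemiring g).
Qed.

Lemma opact_inj p q : (forall a, opact a p = opact a q) -> p = q.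
Proof.
by move=> pq; rewrite -[p]reprK -[q]reprK; apply/eqmodP/asboolP.
Qed.

Lemma map_fterms_neq0 (T : eqType) (f : Gam * S -> T) g : map f (fterms g) != [::].
Proof. by have := fterms_neq0 g; case: (fterms g). Qed.

Lemma fevalD a g h : feval a (g + h) = feval a g + feval a h.
Proof.
rewrite /feval (perm_nesum _ (perm_map _ (ftermsD g h))) map_cat.
by rewrite nesum_cat ?map_fterms_neq0.
Qed.

Lemma fevalDl a b g : feval (a + b) g = feval a g + feval b g.
Proof.
rewrite /feval (eq_map (fun p : Gam * S => gmulDl M a b p.1 p.2)).
rewrite nesum_mapD ?fterms_neq0//.
by congr (_ + _); apply: nesum_default; exact: map_fterms_neq0.
Qed.

Lemma fevalM a g h : feval a (fmul g h) = feval (feval a g) h.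
Proof.
rewrite /feval (perm_nesum _ (perm_map _ (perm_eq_seq_mset _))).
rewrite map_allpairs /=.
elim: (fterms g) (fterms_neq0 g) => // p s IHs _.
have flatten_cons (u : seq S) v : flatten (u :: v) = u ++ flatten v by [].
have Ep : [seq M a p.1 (M p.2 x.1 x.2) | x <- fterms h] =
          [seq M (M a p.1 p.2) x.1 x.2 | x <- fterms h].
  by apply: eq_map => x; exact: gmulA.
have [->|s0] := eqVneq s [::].
  rewrite /= cats0 Ep.
  by apply: nesum_default; exact: map_fterms_neq0.
rewrite map_cons nesum_cons; last by case: (s) s0.
rewrite -/(feval _ h) fevalDl flatten_cons nesum_cat ?map_fterms_neq0//; last first.
  case: (s) s0 => //= p' s' _.
  by have := fterms_neq0 h; case: (fterms h).
rewrite IHs// Ep; congr (_ + _).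
by apply: nesum_default; exact: map_fterms_neq0.
Qed.

Lemma opactD a p q : opact a (opadd p q) = opact a p + opact a q.
Proof. by rewrite opact_pi fevalD. Qed.

Lemma opactDl a b p : opact (a + b) p = opact a p + opact b p.
Proof. exact: fevalDl. Qed.

Lemma opactM a p q : opact a (opmul p q) = opact (opact a p) q.
Proof. by rewrite opact_pi fevalM. Qed.

Lemma opadd_pi g h : opadd (\pi_opsemiring g) (\pi_opsemiring h) =
  \pi_opsemiring (g + h).
Proof. by apply: opact_inj => a; rewrite opactD !opact_pi fevalD. Qed.

Lemma opmul_pi g h : opmul (\pi_opsemiring g) (\pi_opsemiring h) =
  \pi_opsemiring (fmul g h).
Proof. by apply: opact_inj => a; rewrite opactM !opact_pi fevalM. Qed.

Lemma opaddC : commutative opadd.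
Proof. by move=> p q; apply: opact_inj => a; rewrite !opactD Algebra.addrC. Qed.

Lemma opaddA : associative opadd.
Proof.
by move=> p q r; apply: opact_inj => a; rewrite !opactD Algebra.addrA.
Qed.

HB.instance Definition _ := Algebra.isAddSemigroup.Build opsemiring opaddC opaddA.

Lemma opmulA : associative opmul.
Proof. by move=> p q r; apply: opact_inj => a; rewrite !opactM. Qed.

Lemma opmulDl p q r : opmul (p + q) r = opmul p r + opmul q r.
Proof.
by apply: opact_inj => a; rewrite !(opactM, opactD, opactDl).
Qed.

Lemma opmulDr p q r : opmul p (q + r) = opmul p q + opmul p r.
Proof. by apply: opact_inj => a; rewrite !(opactM, opactD). Qed.

Definition is_right_unity p := forall a, opact a p = a.

Definition has_right_unity := exists p, is_right_unity p.

(* [s] lists the pairs (e_i, delta_i). *)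
Definition is_left_unity (s : seq (S * Gam)) :=
  s != [::] /\ forall a, nesum a [seq M u.1 u.2 a | u <- s] = a.

Definition has_left_unity := exists s, is_left_unity s.

End OperatorSemiring.

Section Fuzzy.
Variable R : realType.

(* Fuzzy subsets are functions to [R] with values in [0, 1]. *)
Definition fuzzy_subset (X : Type) (mu : X -> R) := forall x, 0 <= mu x <= 1.

Definition fuzzy_le (X : Type) (mu nu : X -> R) := forall x, mu x <= nu x.

Definition fuzzy_k (X : addSemigroupType) (mu : X -> R) :=
  forall x y, Num.min (mu (x + y)) (mu y) <= mu x.

Definition fuzzy_h (X : addSemigroupType) (mu : X -> R) :=
  forall x z y1 y2, x + y1 + z = y2 + z -> Num.min (mu y1) (mu y2) <= mu x.

Variables (S Gam : addSemigroupType) (M : gammaSemiring S Gam).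

Definition gfuzzy_ideal (mu : S -> R) :=
  [/\ fuzzy_subset mu,
      forall a b, Num.min (mu a) (mu b) <= mu (a + b),
      forall a al b, mu a <= mu (M a al b)
    & forall a al b, mu b <= mu (M a al b)].

Definition opfuzzy_ideal (mu : opsemiring M -> R) :=
  [/\ fuzzy_subset mu,
      forall p q, Num.min (mu p) (mu q) <= mu (p + q),
      forall p q, mu p <= mu (opmul p q)
    & forall p q, mu q <= mu (opmul p q)].

Definition gfuzzy_k_ideals : set (S -> R) :=
  [set mu | gfuzzy_ideal mu /\ fuzzy_k mu].
Definition gfuzzy_h_ideals : set (S -> R) :=
  [set mu | gfuzzy_ideal mu /\ fuzzy_h mu].
Definition opfuzzy_k_ideals : set (opsemiring M -> R) :=
  [set mu | opfuzzy_ideal mu /\ fuzzy_k mu].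
Definition opfuzzy_h_ideals : set (opsemiring M -> R) :=
  [set mu | opfuzzy_ideal mu /\ fuzzy_h mu].

Definition star (sigma : S -> R) : opsemiring M -> R :=
  fun p => inf [set sigma (opact a p) | a in [set: S]].

Lemma star_pi sigma (g : formal_sum S Gam) :
  star sigma (\pi_(opsemiring M) g) =
  inf [set sigma (feval M a g) | a in [set: S]].
Proof.
by rewrite /star; congr inf; apply: eq_imagel => a _; rewrite opact_pi.
Qed.

Lemma star_fuzzy sigma : fuzzy_subset sigma -> fuzzy_subset (star sigma).
Proof.
move=> s01 p; have [a0] := gamma_carrier_inhabited M.
have img : [set sigma (opact a p) | a in [set: S]] (sigma (opact a0 p)).
  by exists a0.
apply/andP; split.
  apply: lb_le_inf; first by exists (sigma (opact a0 p)).
  by move=> _ [a _ <-]; have /andP[] := s01 (opact a p).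
apply: (@le_trans _ _ (sigma (opact a0 p))); last by have /andP[] := s01 (opact a0 p).
apply: ge_inf => //; exists 0 => _ [a _ <-].
by have /andP[] := s01 (opact a p).
Qed.

Definition inclusion_preserving (X Y : Type) (A : set (X -> R))
    (f : (X -> R) -> (Y -> R)) :=
  forall sigma tau, A sigma -> A tau ->
    fuzzy_le sigma tau -> fuzzy_le (f sigma) (f tau).

End Fuzzy.

(* Main.v *)
(** The inverse of [star] is [mu |-> (x |-> inf_gamma mu [gamma, x])].  All
    infima are controlled by two decompositions: the left unity writes
    [x = sum_i e_i delta_i x], so [sigma x] is at least the infimum of the
    [sigma (a gamma x)]; and the right unity is a left identity of the operator
    semiring, so [p = sum_j [gamma_j, f_j] p = sum_j [gamma_j, f_j p]] and
    [mu p] is at least the infimum of the [mu [gamma, a p]].  The opposite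
    inequalities are the ideal property.  The k- and h-conditions are only
    transported, pointwise, in both directions. *)

Require Import Defs.
From mathcomp Require Import all_boot all_order all_algebra.
From mathcomp Require Import finmap multiset generic_quotient.
From mathcomp Require Import all_classical all_reals.

Set Implicit Arguments.
Unset Strict Implicit.
Unset Printing Implicit Defensive.
Import Order.TTheory GRing.Theory Num.Theory.
Local Open Scope classical_set_scope.
Local Open Scope quotient_scope.
Local Open Scope ring_scope.

(** * Nonempty sums without a zero *)

Lemma nesum_closed (V : addSemigroupType) (P : V -> Prop) d (s : seq V) :
  (forall x y, P x -> P y -> P (x + y)) -> s != [::] ->
  (forall x, x \in s -> P x) -> P (nesum d s).
Proof.
move=> PD; elim: s => // x s IHs _ Ps.
(* With no zero to start from, the singleton is the base case. *)
have [s0|s0] := eqVneq s [::]; first by rewrite s0; apply: Ps; exact: mem_head.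
rewrite nesum_cons//; apply: PD; first exact/Ps/mem_head.
by apply: IHs => // y ys; apply: Ps; rewrite in_cons ys orbT.
Qed.

(** The default on the right is [f d], so that the empty sequence is covered too. *)
Lemma nesum_morph (V W : addSemigroupType) (f : V -> W) d (s : seq V) :
  {morph f : x y / x + y} -> f (nesum d s) = nesum (f d) (map f s).
Proof.
move=> fD; elim: s => // x s IHs; have [->//|s0] := eqVneq s [::].
by rewrite map_cons !nesum_cons ?fD ?IHs//; case: (s) s0.
Qed.

(** * Generators of the operator semiring *)

Section OperatorGenerators.
Variables (S Gam : addSemigroupType) (M : gammaSemiring S Gam).
Implicit Types (a x : S) (al : Gam) (p q : opsemiring M).

(** The class $[\alpha,x]$ of a one-term formal sum. *)
Definition opgen al x : opsemiring M :=
  \pi_(opsemiring M) (Sub (seq_mset [:: (al, x)])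
    (@seq_mset_neq0 _ _ [:: (al, x)] isT) : formal_sum S Gam).

Lemma opact_opgen a al x : opact a (opgen al x) = M a al x.
Proof.
rewrite opact_pi /feval /fterms /=.
by rewrite (perm_nesum _ (perm_map _ (perm_eq_seq_mset _))).
Qed.

Lemma opgenD al x y : opgen al (x + y) = opgen al x + opgen al y.
Proof. by apply: opact_inj => a; rewrite opactD !opact_opgen gmulDr. Qed.

Lemma gmul_opact a al x p : M a al (opact x p) = opact (M a al x) p.
Proof.
rewrite /opact /feval (nesum_morph _ _ (gmulDr M a al)) -map_comp.
rewrite (eq_map (fun u => gmulA M a al x u.1 u.2)).
by apply: nesum_default; exact: map_fterms_neq0.
Qed.

Lemma opgen_opact al x p : opgen al (opact x p) = opmul (opgen al x) p.
Proof.
by apply: opact_inj => a; rewrite opactM !opact_opgen gmul_opact.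
Qed.

Lemma opgen_gmul al x be y :
  opgen al (M x be y) = opmul (opgen al x) (opgen be y).
Proof. by rewrite -opgen_opact opact_opgen. Qed.

Lemma opsemiring_gen_ind (P : opsemiring M -> Prop) :
  (forall al x, P (opgen al x)) -> (forall p q, P p -> P q -> P (p + q)) ->
  forall p, P p.
Proof.
move=> Pgen PD p.
(* The default [p] is harmless, since [fterms] is never empty. *)
suff -> : p = nesum p [seq opgen u.1 u.2 | u <- fterms (repr p)].
  apply: nesum_closed => //; first exact: map_fterms_neq0.
  by move=> _ /mapP[u _ ->].
apply: opact_inj => a; rewrite (nesum_morph _ _ (opactD a)) -map_comp.
rewrite (eq_map (fun u => opact_opgen a u.1 u.2)).
by apply: nesum_default; exact: map_fterms_neq0.
Qed.

(** By [opactM] the left factor acts first, so a right unity of [S] becomes a left identity here. *)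
Lemma right_unity_opmul1 p q : is_right_unity p -> opmul p q = q.
Proof. by move=> p1; apply: opact_inj => a; rewrite opactM p1. Qed.

End OperatorGenerators.

(** * Bounds on infima *)

Lemma ge_inf_image (R : realType) (T X : Type) (mu : X -> R) (f : T -> X) t :
  fuzzy_subset mu -> inf [set mu (f u) | u in [set: T]] <= mu (f t).
Proof.
move=> mu01; apply: ge_inf; last by exists t.
by exists 0 => _ [u _ <-]; have /andP[] := mu01 (f u).
Qed.

(** [inhabited T] excludes the infimum of the empty set, a junk value. *)
Lemma le_inf_image (R : realType) (T X : Type) (mu : X -> R) (f : T -> X) c :
  inhabited T -> (forall t, c <= mu (f t)) ->
  c <= inf [set mu (f u) | u in [set: T]].
Proof.
move=> [t] cmu; apply: lb_le_inf; first by exists (mu (f t)), t.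
by move=> _ [u _ <-]; exact: cmu.
Qed.

(** * The two maps and the bijection *)

Section Correspondence.
Variables (R : realType) (S Gam : addSemigroupType) (M : gammaSemiring S Gam).
Implicit Types (sigma : S -> R) (mu : opsemiring M -> R) (p : opsemiring M).

Definition unstar mu : S -> R :=
  fun x => inf [set mu (opgen M al x) | al in [set: Gam]].

Lemma star_le sigma a p : fuzzy_subset sigma ->
  star (M := M) sigma p <= sigma (opact a p).
Proof. exact: (ge_inf_image (fun b => opact b p)). Qed.

Lemma le_star sigma p c : (forall a, c <= sigma (opact a p)) ->
  c <= star (M := M) sigma p.
Proof. exact: le_inf_image (gamma_carrier_inhabited M). Qed.

Lemma unstar_le mu al x : fuzzy_subset mu -> unstar mu x <= mu (opgen M al x).
Proof. exact: (ge_inf_image (fun be => opgen M be x)). Qed.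

Lemma le_unstar mu x c : (forall al, c <= mu (opgen M al x)) -> c <= unstar mu x.
Proof. exact: le_inf_image (gamma_index_inhabited M). Qed.

Lemma gfuzzy_ideal_opact sigma a p :
  gfuzzy_ideal M sigma -> sigma a <= sigma (opact a p).
Proof.
move=> [_ sD sl _]; elim/opsemiring_gen_ind: p => [al x|p q ap aq].
  by rewrite opact_opgen.
by rewrite opactD; apply: le_trans (sD _ _); rewrite le_min ap.
Qed.

Lemma star_ideal sigma : gfuzzy_ideal M sigma -> opfuzzy_ideal (star (M := M) sigma).
Proof.
move=> sI; have [s01 sD _ _] := sI; split; first exact: star_fuzzy.
- move=> p q; apply: le_star => a; rewrite opactD; apply: le_trans (sD _ _).
  by rewrite le_min !ge_min !star_le ?orbT.
- move=> p q; apply: le_star => a; rewrite opactM.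
  exact: le_trans (star_le a p s01) (gfuzzy_ideal_opact _ _ sI).
(* [opact a p] is itself one of the points over which [star sigma q] takes its infimum. *)
- by move=> p q; apply: le_star => a; rewrite opactM star_le.
Qed.

Lemma unstar_fuzzy mu : fuzzy_subset mu -> fuzzy_subset (unstar mu).
Proof.
move=> mu01 x; have [al] := gamma_index_inhabited M.
have /andP[_ mu1] := mu01 (opgen M al x).
rewrite (le_trans (unstar_le al x mu01) mu1) andbT.
by apply: le_unstar => be; have /andP[] := mu01 (opgen M be x).
Qed.

(** The identity $[\beta,a\alpha b]=[\beta,a][\alpha,b]$ reduces both product bounds to those of
    [mu]. *)
Lemma unstar_ideal mu : opfuzzy_ideal mu -> gfuzzy_ideal M (unstar mu).
Proof.
move=> [mu01 muD mul mur]; split; first exact: unstar_fuzzy.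
- move=> a b; apply: le_unstar => al; rewrite opgenD; apply: le_trans (muD _ _).
  by rewrite le_min !ge_min !unstar_le ?orbT.
- move=> a al b; apply: le_unstar => be; rewrite opgen_gmul.
  exact: le_trans (unstar_le _ _ mu01) (mul _ _).
- move=> a al b; apply: le_unstar => be; rewrite opgen_gmul.
  exact: le_trans (unstar_le _ _ mu01) (mur _ _).
Qed.

Lemma starK sigma : has_left_unity M -> gfuzzy_ideal M sigma ->
  unstar (star sigma) = sigma.
Proof.
move=> [s [s0 s1]] sI; have [s01 sD _ sr] := sI; have [t01 _ _ _] := star_ideal sI.
apply/funext => x; apply/eqP; rewrite eq_le; apply/andP; split; last first.
  by apply: le_unstar => al; apply: le_star => a; rewrite opact_opgen.
rewrite -[in leRHS](s1 x).
apply: (@nesum_closed _ (fun y => unstar (star (M := M) sigma) x <= sigma y)).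
- by move=> y z xy xz; apply: le_trans (sD _ _); rewrite le_min xy.
- by case: (s) s0.
(* At the term $e_i\delta_i x$, take $\gamma=\delta_i$ in the outer infimum and $a=e_i$ in the inner
   one. *)
- move=> _ /mapP[u _ ->]; apply: le_trans (unstar_le u.2 x t01) _.
  by rewrite -opact_opgen star_le.
Qed.

Lemma unstarK mu : has_right_unity M -> opfuzzy_ideal mu -> star (unstar mu) = mu.
Proof.
move=> [e e1] muI; have [mu01 muD _ mur] := muI.
have u01 := unstar_fuzzy mu01.
apply/funext => p; apply/eqP; rewrite eq_le; apply/andP; split; last first.
  by apply: le_star => a; apply: le_unstar => al; rewrite opgen_opact.
rewrite -[in leRHS](right_unity_opmul1 p e1).
(* Being a unity does not pass to summands, so [e1] is cleared and the bound on [mu (opmul e p)] is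
   proved for arbitrary [e]. *)
elim/opsemiring_gen_ind: e {e1} => [al x|q r pq pr].
  rewrite -opgen_opact.
  exact: le_trans (star_le x p u01) (unstar_le al _ mu01).
by rewrite opmulDl; apply: le_trans (muD _ _); rewrite le_min pq.
Qed.

Lemma star_inclusion_preserving (A : set (S -> R)) :
  A `<=` fuzzy_subset (X := S) ->
  inclusion_preserving A (@star R S Gam M).
Proof.
move=> A01 sigma tau As _ st p; apply: le_star => a.
exact: le_trans (star_le a p (A01 _ As)) (st _).
Qed.

(** Abstract in the extra conditions, so that the k- and h-cases only have to transport theirs. *)
Lemma star_bij (KS : set (S -> R)) (KR : set (opsemiring M -> R)) :
  has_left_unity M -> has_right_unity M ->
  (forall sigma, fuzzy_subset sigma -> KS sigma -> KR (star sigma)) ->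
  (forall mu, fuzzy_subset mu -> KR mu -> KS (unstar mu)) ->
  set_bij [set sigma | gfuzzy_ideal M sigma /\ KS sigma]
    [set mu | opfuzzy_ideal mu /\ KR mu] (@star R S Gam M).
Proof.
move=> hl hr KSR KRS; split.
- move=> sigma [sI sK]; split; first exact: star_ideal.
  by apply: KSR => //; case: sI.
- move=> sigma tau /set_mem[sI _] /set_mem[tI _] st.
  by rewrite -(starK hl sI) st starK.
- move=> mu [mI mK]; exists (unstar mu); last exact: unstarK.
  by split; [exact: unstar_ideal|apply: KRS => //; case: mI].
Qed.

(** * Transport of the k- and h-conditions *)

Lemma star_k sigma : fuzzy_subset sigma -> fuzzy_k sigma ->
  fuzzy_k (star (M := M) sigma).
Proof.
(* Since [opact a] is additive, the condition on [sigma] can be used separately at each [a]. *)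
move=> s01 sk p q; apply: le_star => a; apply: le_trans (sk _ (opact a q)).
by rewrite -opactD le_min !ge_min !star_le ?orbT.
Qed.

Lemma unstar_k mu : fuzzy_subset mu -> fuzzy_k mu -> fuzzy_k (unstar mu).
Proof.
move=> mu01 muk x y; apply: le_unstar => al.
apply: le_trans (muk _ (opgen M al y)).
by rewrite -opgenD le_min !ge_min !unstar_le ?orbT.
Qed.

Lemma star_h sigma : fuzzy_subset sigma -> fuzzy_h sigma ->
  fuzzy_h (star (M := M) sigma).
Proof.
move=> s01 sh p r q1 q2 pq; apply: le_star => a.
apply: le_trans (sh _ (opact a r) (opact a q1) (opact a q2) _).
  by rewrite le_min !ge_min !star_le ?orbT.
by rewrite -!opactD; congr (opact a _).
Qed.

Lemma unstar_h mu : fuzzy_subset mu -> fuzzy_h mu -> fuzzy_h (unstar mu).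
Proof.
move=> mu01 muh x z y1 y2 xy; apply: le_unstar => al.
apply: le_trans (muh _ (opgen M al z) (opgen M al y1) (opgen M al y2) _).
  by rewrite le_min !ge_min !unstar_le ?orbT.
(* Additivity of [opgen M al] carries the equation from [S] to the operator semiring. *)
by rewrite -!opgenD xy.
Qed.

End Correspondence.

Theorem theorem3p13 (R : realType) (S Gam : addSemigroupType)
    (M : gammaSemiring S Gam)
    (hl : has_left_unity M) (hr : has_right_unity M) :
  (set_bij (@gfuzzy_k_ideals R S Gam M) (@opfuzzy_k_ideals R S Gam M)
     (@star R S Gam M) /\
   inclusion_preserving (@gfuzzy_k_ideals R S Gam M) (@star R S Gam M)) /\
  (set_bij (@gfuzzy_h_ideals R S Gam M) (@opfuzzy_h_ideals R S Gam M)
     (@star R S Gam M) /\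
   inclusion_preserving (@gfuzzy_h_ideals R S Gam M) (@star R S Gam M)).
Proof.
split; split.
- by apply: star_bij => //; [exact: star_k|exact: unstar_k].
- by apply: star_inclusion_preserving => sigma [[]].
- by apply: star_bij => //; [exact: star_h|exact: unstar_h].
- by apply: star_inclusion_preserving => sigma [[]].
Qed.
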